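(* There exist $K^2$ discrete involutions remaining stationary for any initial data subject to evolution according to SUPG-GFq with $\mathbb Q^K$ finite elements. Precisely: for all $t_x,t_y\in\mathbb C$ with $|t_x|=|t_y|=1$ there exist $K^2$ linearly independent vectors $\ell\in\mathbb C^{3K^2}$ such that $\ell^{T}\hat{\mathcal E}(t_x,t_y)=0$; hence for every solution $\hat q(t)\in\mathbb C^{3K^2}$ of $\hat{\mathcal A}(t_x,t_y)\,\frac{d}{dt}\hat q+\hat{\mathcal E}(t_x,t_y)\,\hat q=0$ the quantity $\ell^{T}\hat{\mathcal A}(t_x,t_y)\,\hat q(t)$ is constant in time, where $\hat{\mathcal A},\hat{\mathcal E}$ are the symbols of the SUPG-GFq matrices.
   Context: Grid: unbounded uniform Cartesian grid, cells $E^x_i=[x_i,x_{i+1}]$ of length $\Delta x$, $i\in\mathbb Z$, and $E_j^y$ of length $\Delta y$, $j\in\mathbb Z$; $h=\min\{\Delta x,\Delta y\}$; $K\ge1$. With Gauss–Lobatto points $0=\xi_0<\dots<\xi_K=1$ of $[0,1]$, $x_{i,s}=x_i+\xi_s\Delta x$ (so $x_{i,0}=x_{i-1,K}$); the distinct nodes are indexed by $(i,s)$ with $i\in\mathbb Z$, $s=1,\dots,K$. $\varphi^x_{i,s}$ are the continuous, piecewise degree-$K$ Lagrange basis functions. Matrices: $(M_x)_{\alpha\beta}=\int\varphi^x_\alpha\varphi^x_\beta$, $(D_x)_{\alpha\beta}=\int\varphi^x_\alpha\partial_x\varphi^x_\beta$, $(D^x)_{\alpha\beta}=\int\partial_x\varphi^x_\alpha\varphi^x_\beta$,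 $(D^x_x)_{\alpha\beta}=\int\partial_x\varphi^x_\alpha\partial_x\varphi^x_\beta$, with integrals evaluated by Gauss–Lobatto quadrature at the nodes. For a finite element function $w$ let $\mathcal I w$ be the cellwise polynomial which on $E^x_i$ has degree $\le K$ and takes the value $\int_{x_i}^{x_{i,s}}w\,dx$ at $x_{i,s}$, $s=0,\dots,K$; then $(D_xI_x)_{\alpha\beta}=\sum_i\int_{E^x_i}\varphi^x_\alpha\,\partial_x(\mathcal I\varphi^x_\beta)\,dx$ and $(D^x_xI_x)_{\alpha\beta}=\sum_i\int_{E^x_i}\partial_x\varphi^x_\alpha\,\partial_x(\mathcal I\varphi^x_\beta)\,dx$. Same definitions in $y$. Symbols: each such matrix $A$ is translation invariant, $(Aw)_{i,s}=\sum_{k}\sum_{p=1}^K a^s_{k,p}w_{i+k,p}$ with finitely many nonzero coefficients, and its symbol is the $K\times K$ matrix $(\mathbb F_{t_x}(A))_{s,p}=\sum_ka^s_{k,p}t_x^k$; the symbol of $A\otimes B$ is the Kronecker product $\mathbb F_{t_x}(A)\otimes\mathbb F_{t_y}(B)$ (size $K^2\times K^2$). The symbol of a $3\times3$ block matrix is taken blockwise (size $3K^2\times3K^2$). The SUPG-GFq semi-discretization of linear acoustics $\partial_tu+\partial_xp=0$, $\partial_tv+\partial_yp=0$, $\partial_tp+\partial_xu+\partial_yv=0$ is $\mathcal A\frac{d}{dt}q+\mathcal Eq=0$ for $q=(u,v,p)$, with stabilization constant $\alpha$ and $$\mathcal A=\begin{pmatrix} M_x\otimes M_y&0&\alpha hD^x\otimes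 M_y \\ 0&M_x\otimes M_y&\alpha hM_x\otimes D^y \\ \alpha hD^x\otimes M_y&\alpha hM_x\otimes D^y&M_x\otimes M_y \end{pmatrix},$$ $$\mathcal E=\begin{pmatrix} \alpha hD^x_x\otimes(D_yI_y)&\alpha h(D^x_xI_x)\otimes D_y&D_x\otimes M_y \\ \alpha hD_x\otimes(D^y_yI_y)&\alpha h(D_xI_x)\otimes D^y_y&M_x\otimes D_y \\ {D_x}\otimes(D_yI_y)&(D_xI_x)\otimes D_y&\alpha h(D^x_x\otimes M_y+M_x\otimes D^y_y) \end{pmatrix}.$$ $\hat{\mathcal A}(t_x,t_y)$ and $\hat{\mathcal E}(t_x,t_y)$ denote their symbols; they govern the Fourier modes $q_{i,s;j,r}(t)=t_x^it_y^j\hat q_{s,r}(t)$. Discrete involutions are the quantities associated with left-kernel vectors of the symbol of $\mathcal E$. *)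

(* Defs.v *)
From HB Require Import structures.
From mathcomp Require Import all_boot all_order all_algebra.
From mathcomp Require Import all_classical all_reals all_analysis.
From mathcomp.real_closed Require Import complex mxtens.

Set Implicit Arguments.
Unset Strict Implicit.
Unset Printing Implicit Defensive.

Import Order.TTheory GRing.Theory Num.Theory.
Import numFieldNormedType.Exports.

Local Open Scope classical_set_scope.
Local Open Scope ring_scope.

Section Lobatto.
Variable R : realType.

(* Legendre polynomial of degree K transported from [-1, 1] to [0, 1]:
   Rodrigues' formula (1 / (2^K K!)) (d/dz)^K (z^2 - 1)^K with z = 2 x - 1.
   The divided derivative ^`N(K) accounts for the 1 / K!. *)
Definition legendre (K : nat) : {poly R} := (('X * ('X - 1)) ^+ K)^`N(K).

(* The two endpoints and the K - 1 zeros of the derivative of the Legendre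
   polynomial of degree K, in increasing order. *)
Definition gauss_lobatto (K : nat) (xi : 'I_K.+1 -> R) : Prop :=
  [/\ xi ord0 = 0,
      xi ord_max = 1,
      forall r s : 'I_K.+1, (r < s)%N -> xi r < xi s
    & forall s : 'I_K.+1, (0 < s < K)%N -> root (legendre K)^`() (xi s)].

End Lobatto.

Section OneDimension.
Variables (R : realType) (K : nat) (xi : 'I_K.+1 -> R).
(* x_i = x0 + i dx *)
Variables (x0 dx : R).

Definition node (i : int) (s : 'I_K.+1) : R := x0 + dx *~ i + xi s * dx.

Definition cell_left (i : int) : R := x0 + dx *~ i.
Definition cell_right (i : int) : R := x0 + dx *~ (i + 1).

Definition integral (a b : R) (p : {poly R}) : R :=
  \int[lebesgue_measure]_(x in `[a, b]) p.[x].

Definition lagrange_cell (i : int) (s : 'I_K.+1) : {poly R} :=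
  \prod_(r < K.+1 | r != s)
    ((node i s - node i r)^-1 *: ('X - (node i r)%:P)).

(* The polynomial of degree <= K taking the value v s at x_{i,s}. *)
Definition interpolate (i : int) (v : 'I_K.+1 -> R) : {poly R} :=
  \sum_(s < K.+1) v s *: lagrange_cell i s.

(* Interpolatory weights, i.e. integrals of the Lagrange polynomials. *)
Definition quadrature (i : int) (f : {poly R}) : R :=
  \sum_(s < K.+1)
    integral (cell_left i) (cell_right i) (lagrange_cell i s)
      * f.[node i s].

(* A piecewise polynomial function, given by its restriction to each cell.
   Its derivative is taken cellwise, so at a common node of two cells the
   derivative is the one seen from inside the cell under consideration. *)
Definition piecewise : Type := int -> {poly R}.

(* (i, s) : dof stands for the pair (i, s + 1), with 1 <= s + 1 <= K. *)
Definition dof : Type := (int * 'I_K)%type.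

Definition dof_node (a : dof) : R := node a.1 (lift ord0 a.2).

(* The continuous Lagrange basis function: it is 1 at the node of a and
   0 at all others. The last node of a cell is the first node of the next one,
   so phi (i, K) is non-zero on two cells. *)
Definition phi (a : dof) : piecewise :=
  fun i => interpolate i (fun r => (node i r == dof_node a)%:R).

Definition cell_primitive (w : piecewise) : piecewise :=
  fun i => interpolate i (fun s => integral (cell_left i) (node i s) (w i)).

Definition fe_matrix : Type := dof -> dof -> R.

(* In all the sums below only finitely many terms are non-zero. *)

Definition mat_M : fe_matrix := fun a b =>
  \sum_(i \in [set: int]) quadrature i (phi a i * phi b i).

(* D_x *)
Definition mat_Dl : fe_matrix := fun a b =>
  \sum_(i \in [set: int]) quadrature i (phi a i * (phi b i)^`()).

(* D^x *)
Definition mat_Du : fe_matrix := fun a b =>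
  \sum_(i \in [set: int]) quadrature i ((phi a i)^`() * phi b i).

(* D^x_x *)
Definition mat_Dul : fe_matrix := fun a b =>
  \sum_(i \in [set: int]) quadrature i ((phi a i)^`() * (phi b i)^`()).

(* D_x I_x *)
Definition mat_DlI : fe_matrix := fun a b =>
  \sum_(i \in [set: int])
    integral (cell_left i) (cell_right i)
      (phi a i * (cell_primitive (phi b) i)^`()).

(* D^x_x I_x *)
Definition mat_DulI : fe_matrix := fun a b =>
  \sum_(i \in [set: int])
    integral (cell_left i) (cell_right i)
      ((phi a i)^`() * (cell_primitive (phi b) i)^`()).

(* For a translation invariant A the coefficient a^s_{k,p} is the entry at
   row (i, s), column (i + k, p), for any i; it is read off at i = 0. *)
Definition symbol (A : fe_matrix) (t : R[i]) : 'M[R[i]]_K :=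
  \matrix_(s, p) \sum_(k \in [set: int]) (A (0, s) (k, p))%:C%C * t ^ k.

End OneDimension.

Section BlockMatrix.
Variables (T : Type) (n : nat).

Definition block3_mx (A11 A12 A13 A21 A22 A23 A31 A32 A33 : 'M[T]_n) :
    'M[T]_(n + (n + n)) :=
  block_mx A11 (row_mx A12 A13)
           (col_mx A21 A31) (block_mx A22 A23 A32 A33).

End BlockMatrix.

Section SupgGfq.
Variables (R : realType) (K : nat) (xi : 'I_K.+1 -> R).
Variables (x0 y0 dx dy alpha : R) (tx ty : R[i]).

Let Mx := symbol (mat_M xi x0 dx) tx.
Let Dx := symbol (mat_Dl xi x0 dx) tx.
Let D'x := symbol (mat_Du xi x0 dx) tx.
Let D'xx := symbol (mat_Dul xi x0 dx) tx.
Let DxIx := symbol (mat_DlI xi x0 dx) tx.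
Let D'xxIx := symbol (mat_DulI xi x0 dx) tx.

Let My := symbol (mat_M xi y0 dy) ty.
Let Dy := symbol (mat_Dl xi y0 dy) ty.
Let D'y := symbol (mat_Du xi y0 dy) ty.
Let D'yy := symbol (mat_Dul xi y0 dy) ty.
Let DyIy := symbol (mat_DlI xi y0 dy) ty.
Let D'yyIy := symbol (mat_DulI xi y0 dy) ty.

Let ah : R[i] := (alpha * Num.min dx dy)%:C%C.

Definition Ahat : 'M[R[i]]_(K * K + (K * K + K * K)) :=
  block3_mx
    (Mx *t My)          0                   (ah *: (D'x *t My))
    0                   (Mx *t My)          (ah *: (Mx *t D'y))
    (ah *: (D'x *t My)) (ah *: (Mx *t D'y)) (Mx *t My).

Definition Ehat : 'M[R[i]]_(K * K + (K * K + K * K)) :=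
  block3_mx
    (ah *: (D'xx *t DyIy)) (ah *: (D'xxIx *t Dy)) (Dx *t My)
    (ah *: (Dx *t D'yyIy)) (ah *: (DxIx *t D'yy)) (Mx *t Dy)
    (Dx *t DyIy) (DxIx *t Dy) (ah *: (D'xx *t My + Mx *t D'yy)).

End SupgGfq.

Section LinearODE.
Variables (R : realType) (n : nat).

(* q solves A q' + E q = 0 on the interval J: it is continuous on J and the
   equation holds at the interior points. A complex function of the real
   variable t is differentiated through its real and imaginary parts. *)
Definition is_solution (A E : 'M[R[i]]_n) (J : interval R)
    (q : R -> 'cV[R[i]]_n) : Prop :=
  (forall j : 'I_n,
     {within [set` J], continuous (fun t => complex.Re (q t j 0))} /\
     {within [set` J], continuous (fun t => complex.Im (q t j 0))}) /\
  (forall t : R, [set` J]° t ->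
     exists2 dq : 'cV[R[i]]_n,
       forall j : 'I_n,
         is_derive t 1 (fun u => complex.Re (q u j 0)) (complex.Re (dq j 0)) /\
         is_derive t 1 (fun u => complex.Im (q u j 0)) (complex.Im (dq j 0))
     & A *m dq + E *m q t = 0).

End LinearODE.

(* Main.v *)
Require Import Defs.
From mathcomp Require Import all_boot all_order all_algebra.
From mathcomp Require Import all_classical all_reals all_analysis.
From mathcomp.real_closed Require Import complex mxtens cauchyreals polyorder.
From mathcomp Require Import ring lra zify.
Import Order.TTheory GRing.Theory Num.Theory.
Import numFieldNormedType.Exports.
Local Open Scope classical_set_scope.
Local Open Scope ring_scope.

Set Implicit Arguments.
Unset Strict Implicit.
Unset Printing Implicit Defensive.

(** Each one-dimensional matrix that occurs in the first two block columns of
    [Ehat] has the form: test a function (phi or its derivative) against the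
    cellwise derivative of a trial function (phi or its cell primitive).  That
    derivative is a polynomial of degree less than K on every cell, so the
    matrix is a composition: first take the derivative in the space of
    piecewise polynomials of degree < K, which has K unknowns per cell, then
    test.  On symbols this is a product of two K x K matrices
    ([symbol_factor]).

    The composition uses one test matrix for D_x and D_x I_x, although the
    former is computed with Gauss-Lobatto quadrature and the latter exactly.
    This is legitimate because the quadrature is exact up to degree 2K - 1
    ([quadrature_exact]), while phi * phi' has at most that degree.
    With B, C the symbols of testing against phi and phi', and G, H those of
    differentiating phi and its cell primitive, one obtains
      D_x = B G,   D_x I_x = B H,   D^x_x = C G,   D^x_x I_x = C H
    ([symbols_factor]).  By the mixed product rule the first two block columns
    of [Ehat] are, up to the scalar factors alpha h on the first two block
    rows,
      [C (x) B'; B (x) C'; B (x) B'] * [G (x) H', H (x) G'],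
    primes denoting the y direction.  This passes through a space of dimension
    K^2; so these 2K^2 columns have rank at most K^2, and the third block column
    adds at most K^2.  Hence rank Ehat <= 2K^2 ([rank_supg]), and the left
    kernel of this 3K^2 x 3K^2 matrix has dimension at least K^2.

    A left-kernel vector l of E gives l A q' = - l E q = 0 along solutions, so
    l A q is constant ([left_kernel_conserved]). *)

(** * Integrals of polynomials *)

Lemma integral_deriv (R : realType) (a b : R) (P : {poly R}) :
  a <= b -> Defs.integral a b P^`() = P.[b] - P.[a].
Proof.
rewrite le_eqVlt => /orP[/eqP->|ab].
  by rewrite /Defs.integral set_itv1 Rintegral_set1 subrr.
rewrite /Defs.integral /Rintegral (@continuous_FTC2 R _ (horner P) a b ab) //=.
- by apply: continuous_subspaceT => x; apply: continuous_horner.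
- split.
  + by move=> x _; apply: derivable_horner.
  + by apply: cvg_at_right_filter; apply: continuous_horner.
  + by apply: cvg_at_left_filter; apply: continuous_horner.
- move=> x _; rewrite derive1E; apply: derive_val.
Qed.

(** Since every polynomial is a derivative, the algebra of the integral below
    reduces to the fundamental theorem [integral_deriv], with no integrability
    side conditions. *)
Lemma poly_primitive (R : realType) (p : {poly R}) : exists P : {poly R}, p = P^`().
Proof.
exists (\poly_(i < (size p).+1) (p`_i.-1 / i%:R)).
apply/polyP => i; rewrite coef_deriv coef_poly ltnS -[LHS]/(p`_i).
case: ltnP => hi; last by rewrite nth_default ?mul0rn.
by rewrite -[RHS]mulr_natr mulfVK ?pnatr_eq0.
Qed.

Lemma integralZD (R : realType) (a b c : R) (p q : {poly R}) : a <= b ->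
  Defs.integral a b (c *: p + q) = c * Defs.integral a b p + Defs.integral a b q.
Proof.
move=> ab; have [P ->] := poly_primitive p; have [Q ->] := poly_primitive q.
rewrite -derivZ -derivD !integral_deriv// !(hornerD, hornerZ); ring.
Qed.

Lemma integral0 (R : realType) (a b : R) : a <= b -> Defs.integral a b 0 = 0.
Proof. by move=> ab; rewrite -(derivC 0) integral_deriv// !hornerC subrr. Qed.

Lemma integral_lincomb (R : realType) (I : Type) (r : seq I) (a b : R)
    (c : I -> R) (p : I -> {poly R}) : a <= b ->
  Defs.integral a b (\sum_(j <- r) c j *: p j) =
    \sum_(j <- r) c j * Defs.integral a b (p j).
Proof.
move=> ab; elim: r => [|j r IH]; first by rewrite !big_nil integral0.
by rewrite !big_cons integralZD// IH.
Qed.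

Lemma integral_comp_affine (R : realType) (c h u v : R) (p : {poly R}) :
  0 < h -> u <= v ->
  Defs.integral (c + h * u) (c + h * v) p =
    h * Defs.integral u v (p \Po (h *: 'X + c%:P)).
Proof.
move=> h0 uv; have [P ->] := poly_primitive p.
have uv' : c + h * u <= c + h * v by rewrite lerD2l ler_pM2l.
have -> : P^`() \Po (h *: 'X + c%:P) = h^-1 *: (P \Po (h *: 'X + c%:P))^`().
  rewrite deriv_comp derivD derivZ derivX derivC addr0 -scalerAr mulr1.
  by rewrite scalerA mulVf ?scale1r// gt_eqF.
rewrite -derivZ !integral_deriv// !hornerZ !horner_comp !hornerE.
by rewrite -mulrBr mulVKf ?gt_eqF// ![_ + c]addrC.
Qed.

Lemma integral_by_parts (R : realType) (a b : R) (P Q : {poly R}) : a <= b ->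
  root P a -> root P b ->
  Defs.integral a b (P^`() * Q) = - Defs.integral a b (P * Q^`()).
Proof.
move=> ab /rootP Pa /rootP Pb; apply/eqP; rewrite -addr_eq0; apply/eqP.
rewrite -[X in X + _]mul1r -integralZD// scale1r -derivM integral_deriv//.
by rewrite !hornerM Pa Pb !mul0r subrr.
Qed.

Lemma size_comp_affine (R : realType) (c h : R) (p : {poly R}) : 0 < h ->
  size (p \Po (h *: 'X + c%:P)) = size p.
Proof.
move=> h0; apply: size_comp_poly2.
by rewrite size_polyDl size_scale ?gt_eqF// size_polyX// ltnS size_polyC_leq1.
Qed.

(** * Exactness of Gauss-Lobatto quadrature *)

Definition bubble (R : realType) : {poly R} := 'X * ('X - 1).

Lemma bubble_root (R : realType) (p : {poly R}) :
  bubble R %| p -> root p 0 /\ root p 1.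
Proof.
by move=> /dvdpP[q ->]; split; apply/rootP; rewrite /bubble !hornerE /= ?subrr ?mulr0 ?mul0r.
Qed.

Lemma dvdp_bubble_deriv (R : realType) (n : nat) (p : {poly R}) :
  bubble R ^+ n.+1 %| p -> bubble R ^+ n %| p^`().
Proof.
move=> /dvdpP[q ->]; rewrite derivM; apply: dvdp_add.
  by apply/dvdp_mull/dvdp_exp2l.
by rewrite deriv_exp; apply/dvdp_mull; rewrite -mulr_natl; apply/dvdp_mull/dvdp_mull.
Qed.

(** Integrating by parts moves the n derivatives onto g, which they annihilate.
    The boundary terms vanish because a multiple of bubble^n keeps the factor
    bubble as long as fewer than n derivatives are taken. *)
Lemma rodrigues_orthogonal (R : realType) (n : nat) (p g : {poly R}) :
  bubble R ^+ n %| p -> (size g <= n)%N ->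
  Defs.integral 0 1 (p^`(n) * g) = 0.
Proof.
elim: n p g => [|n IH] p g dvd.
  by rewrite leqn0 size_poly_eq0 => /eqP->; rewrite mulr0 integral0 ?ler01.
move=> szg.
have [r0 r1] : root p^`(n) 0 /\ root p^`(n) 1.
  apply: bubble_root; rewrite -[bubble R]expr1.
  elim: n p {IH szg} dvd => [|n IHn] p dvd //.
  by rewrite derivSn; apply/IHn/dvdp_bubble_deriv.
rewrite derivnS integral_by_parts ?ler01// IH ?oppr0//.
  by apply: dvdp_trans dvd; apply: dvdp_exp2l.
have [->|g0] := eqVneq g 0; first by rewrite deriv0 size_poly0.
by rewrite -ltnS (leq_trans (lt_size_deriv g0)).
Qed.

Lemma legendre_orthogonal (R : realType) (K : nat) (g : {poly R}) :
  (size g <= K)%N -> Defs.integral 0 1 (legendre R K * g) = 0.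
Proof.
move=> szg; have := rodrigues_orthogonal (dvdpp (bubble R ^+ K)) szg.
rewrite nderivn_def -mulr_natl -/(legendre R K) -mulrA mulr_natl.
rewrite -scaler_nat -[_ *: _]addr0 integralZD ?ler01// integral0 ?ler01// addr0.
by move=> /eqP; rewrite mulf_eq0 pnatr_eq0 -leqn0 leqNgt fact_gt0 => /eqP.
Qed.

Lemma size_bubble (R : realType) : size (bubble R) = 3.
Proof. by rewrite /bubble mulrC -polyC1 size_mulX ?polyXsubC_eq0// size_XsubC. Qed.

Lemma size_legendre (R : realType) (K : nat) : size (legendre R K) = K.+1.
Proof.
rewrite /legendre size_nderivn -[_ * _]/(bubble R).
have /prednK <- : (0 < size (bubble R ^+ K))%N.
  by rewrite size_poly_gt0 expf_neq0// -size_poly_gt0 size_bubble.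
by rewrite size_exp size_bubble /=; lia.
Qed.

Lemma lobatto_inj (R : realType) (K : nat) (xi : 'I_K.+1 -> R) :
  gauss_lobatto xi -> injective xi.
Proof.
move=> [_ _ xilt _] r s /eqP; apply: contraTeq; rewrite neq_ltn.
by case/orP => /xilt H; rewrite ?(lt_eqF H) ?(gt_eqF H).
Qed.

(** The nodes are exactly the K + 1 roots of N = bubble * L', where L is the
    Legendre polynomial of degree K.  Hence g = q N with deg q <= K - 2, and an
    integration by parts turns the integral of q * bubble * L' into minus that
    of (q * bubble)' * L, where L is orthogonal to polynomials of degree < K. *)
Lemma lobatto_vanishing (R : realType) (K : nat) (xi : 'I_K.+1 -> R)
    (g : {poly R}) :
  gauss_lobatto xi -> (0 < K)%N -> (size g <= 2 * K)%N ->
  (forall s, root g (xi s)) -> Defs.integral 0 1 g = 0.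
Proof.
move=> lob K0 szg g0; have [xi0 xiK _ xir] := lob.
pose N := bubble R * (legendre R K)^`().
have size_N : size N = K.+2.
  rewrite /N size_mul -?size_poly_gt0 ?size_bubble// size_deriv size_legendre//.
have N0 s : root N (xi s).
  rewrite /N rootM.
  have [r0 r1] := bubble_root (dvdpp (bubble R)).
  have [->|s0] := eqVneq s ord0; first by rewrite xi0 r0.
  have [->|sK] := eqVneq s ord_max; first by rewrite xiK r1.
  rewrite (xir s) ?orbT//; move: s0 sK (ltn_ord s); rewrite -!val_eqE /=; lia.
pose rs := [seq xi s | s <- enum 'I_K.+1].
have uniq_rs : uniq_roots rs.
  by rewrite uniq_rootsE (map_inj_uniq (lobatto_inj lob)) enum_uniq.
have size_rs : size N = (size rs).+1 by rewrite size_N size_map size_enum_ord.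
have all_rs p : (forall s, root p (xi s)) -> all (root p) rs.
  by move=> p0; apply/allP => x /mapP[s _ ->].
have NE := all_roots_prod_XsubC size_rs (all_rs _ N0) uniq_rs.
have [q gE] : exists q : {poly R}, g = q * N.
  apply/dvdpP; rewrite NE dvdpZl ?uniq_roots_dvdp ?all_rs//.
  by rewrite lead_coef_eq0 -size_poly_gt0 size_N.
have [->|gn0] := eqVneq g 0; first by rewrite integral0 ?ler01.
have [qn0 Nn0] : q != 0 /\ N != 0.
  by apply/andP; rewrite -negb_or -mulf_eq0 -gE.
have szq : (size q + 2 <= K.+1)%N.
  move: szg; rewrite gE size_mul// size_N; move: (size q) => m; lia.
pose P := bubble R * q.
have [P0 P1] : root P 0 /\ root P 1 by apply/bubble_root/dvdp_mulr/dvdpp.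
have -> : g = P * (legendre R K)^`() by rewrite gE /N /P; ring.
apply/eqP; rewrite -oppr_eq0 -integral_by_parts ?ler01// mulrC; apply/eqP.
apply: legendre_orthogonal; rewrite size_deriv /P size_mul -?size_poly_eq0 ?size_bubble//=.
  by move: szq; move: (size q) => m; lia.
by rewrite size_poly_eq0.
Qed.

Lemma fsbig_int_support (V : nmodType) (r : seq int) (f : int -> V) : uniq r ->
  (forall i, i \notin r -> f i = 0) ->
  \sum_(i \in [set: int]) f i = \sum_(i <- r) f i.
Proof.
move=> ur f0; rewrite (fsbigE r)// => [|i _]; last exact: f0.
by apply: eq_bigl => i; rewrite in_setT.
Qed.

Section Grid.
Variables (R : realType) (K : nat) (xi : 'I_K.+1 -> R) (x0 dx : R).
Hypotheses (hK : (0 < K)%N) (hxi : gauss_lobatto xi) (hdx : 0 < dx).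

Let left := cell_left x0 dx.

Lemma nodeE i s : node xi x0 dx i s = left i + dx * xi s.
Proof. by rewrite /node mulrC. Qed.

(* The two endpoints written as images of 0 and 1 under the affine map of the
   cell, which is the shape that integral_comp_affine expects. *)
Lemma cell_leftE i : cell_left x0 dx i = left i + dx * 0.
Proof. by rewrite mulr0 addr0. Qed.

Lemma cell_rightE i : cell_right x0 dx i = left i + dx * 1.
Proof. by rewrite /cell_right /left /cell_left mulrzDr mulr1z mulr1 addrA. Qed.

Lemma cell_le i : cell_left x0 dx i <= cell_right x0 dx i.
Proof. by rewrite cell_leftE cell_rightE lerD2l ler_pM2l ?ler01. Qed.

Lemma lobatto_ge0 s : 0 <= xi s.
Proof.
have [xi0 _ xilt _] := hxi; have [->|s0] := eqVneq s ord0; first by rewrite xi0.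
by rewrite -xi0 ltW// xilt// lt0n.
Qed.

Lemma lobatto_gt0 (p : 'I_K) : 0 < xi (lift ord0 p).
Proof. by have [xi0 _ xilt _] := hxi; rewrite -xi0 xilt. Qed.

Lemma lobatto_le1 s : xi s <= 1.
Proof.
have [_ xiK xilt _] := hxi; have [->|sK] := eqVneq s ord_max; first by rewrite xiK.
rewrite -xiK ltW// xilt//.
by move: sK (ltn_ord s); rewrite -val_eqE /=; lia.
Qed.

Lemma node_inj i : injective (node xi x0 dx i).
Proof.
move=> r s /addrI /(mulIf _) H; apply/(lobatto_inj hxi)/H; by rewrite gt_eqF.
Qed.

Lemma lagrange_node i r s : (lagrange_cell xi x0 dx i s).[node xi x0 dx i r] = (r == s)%:R.
Proof.
rewrite /lagrange_cell horner_prod; have [->|rs] := eqVneq r s.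
  rewrite big1// => u us; rewrite !hornerE mulVf// subr_eq0.
  by apply: contra us => /eqP/node_inj->.
by rewrite (bigD1 r)//= !hornerE subrr mulr0 mul0r.
Qed.

Lemma interpolate_node i v r : (interpolate xi x0 dx i v).[node xi x0 dx i r] = v r.
Proof.
rewrite /interpolate horner_sum (bigD1 r)//= big1 => [|s sr].
  by rewrite hornerZ lagrange_node eqxx mulr1 addr0.
by rewrite hornerZ lagrange_node eq_sym (negPf sr) mulr0.
Qed.

Lemma size_interpolate i v : (size (interpolate xi x0 dx i v) <= K.+1)%N.
Proof.
apply: (leq_trans (size_sum _ _ _)); apply/bigmax_leqP => s _.
apply: (leq_trans (size_scale_leq _ _)).
rewrite /lagrange_cell scaler_prod; apply: (leq_trans (size_scale_leq _ _)).
apply: (leq_trans (size_prod_leq _ _)).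
under eq_bigr do rewrite size_XsubC.
by rewrite sum_nat_const cardC1 card_ord /=; lia.
Qed.

(** The quadrature integrates the interpolant of f at the nodes, so its error is
    the integral of a polynomial that vanishes at all of them. *)
Lemma quadrature_exact i (f : {poly R}) : (size f <= 2 * K)%N ->
  quadrature xi x0 dx i f = Defs.integral (cell_left x0 dx i) (cell_right x0 dx i) f.
Proof.
move=> szf; have cle := cell_le i.
rewrite /quadrature; under eq_bigr do rewrite mulrC.
rewrite -integral_lincomb// -/(interpolate xi x0 dx i (fun s => f.[node xi x0 dx i s])).
set g := interpolate _ _ _ _ _.
apply/eqP; rewrite -subr_eq0 -mulN1r addrC -integralZD// scaleN1r; apply/eqP.
rewrite {1}cell_leftE {1}cell_rightE integral_comp_affine ?ler01//.
rewrite (@lobatto_vanishing R K xi) ?mulr0//.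
  rewrite size_comp_affine// (leq_trans (size_polyD _ _))// size_polyN geq_max szf.
  by rewrite (leq_trans (size_interpolate _ _))//; lia.
move=> s; apply/rootP; rewrite horner_comp.
have -> : (dx *: 'X + (left i)%:P).[xi s] = node xi x0 dx i s.
  by rewrite hornerD hornerZ hornerX hornerC addrC -nodeE.
by rewrite hornerD hornerN interpolate_node addNr.
Qed.

(** * Trial and test functions under translation *)

(** Coincidence of nodes depends on the cells through i - k only; both the
    translation invariance and the support of the basis functions follow. *)
Lemma node_eq i k r s :
  (node xi x0 dx i r == node xi x0 dx k s) = ((i - k)%:~R == xi s - xi r).
Proof.
have dx0 : dx != 0 by rewrite gt_eqF.
rewrite -[in RHS](inj_eq (mulfI dx0)) -[in RHS]subr_eq0 -[in LHS]subr_eq0; congr (_ == 0).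
by rewrite /node intrB -(mulrzr dx i) -(mulrzr dx k); ring.
Qed.

(** A polynomial seen from cell i, in the coordinate of the reference interval
    [0, 1]. *)
Definition pull (i : int) (p : {poly R}) : {poly R} :=
  p \Po (dx *: 'X + (left i)%:P).

(** The function of index (k, p) lives on cell k, and on cell k + 1 when its node
    is their common endpoint. *)
Definition two_cell_support (w : dof K -> piecewise R) : Prop :=
  forall k p i, i != k -> i != k + 1 -> w (k, p) i = 0.

Definition translation_invariant (w : dof K -> piecewise R) : Prop :=
  forall k p i, pull (i + 1) (w (k + 1, p) (i + 1)) = pull i (w (k, p) i).

Lemma pull_interpolate i v : pull (i + 1) (interpolate xi x0 dx (i + 1) v) =
  pull i (interpolate xi x0 dx i v).
Proof.
rewrite /pull /interpolate !raddf_sum /=; apply: eq_bigr => s _.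
rewrite !comp_polyZ; congr (_ *: _).
rewrite /lagrange_cell !rmorph_prod; apply: eq_bigr => r _ /=.
rewrite !comp_polyZ !comp_polyB !comp_polyX !comp_polyC !nodeE.
by congr (_^-1 *: _); [ring | rewrite !polyCD; ring].
Qed.

Lemma interpolate0 i : interpolate xi x0 dx i (fun=> 0) = 0.
Proof. by rewrite /interpolate big1// => s _; rewrite scale0r. Qed.

Lemma phi_support : two_cell_support (phi xi x0 dx).
Proof.
move=> k p i ik ik1; rewrite /phi -[RHS](interpolate0 i); congr interpolate.
apply/funext => r; rewrite /dof_node node_eq; case: eqP => // H.
have := lobatto_gt0 p; have := lobatto_le1 (lift ord0 p).
have := lobatto_ge0 r; have := lobatto_le1 r.
move=> r1 r0 p1 p0.
(* Degrees of freedom exclude the left endpoint of their cell, whence the strict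
   inequality, which rules out i = k - 1. *)
have : -1 < (i - k)%:~R :> R by rewrite H; lra.
have : (i - k)%:~R <= 1 :> R by rewrite H; lra.
rewrite -[1]/(1%:~R) -(mulrNz 1) ler_int ltr_int.
move: ik ik1; lia.
Qed.

Lemma phi_translation : translation_invariant (phi xi x0 dx).
Proof.
move=> k p i; rewrite /phi -[RHS]pull_interpolate; congr (pull _ (interpolate _ _ _ _ _)).
apply/funext => r; rewrite /dof_node !node_eq /=; congr ((_%:~R == _)%:R); ring.
Qed.

Lemma cell_primitive_support w : two_cell_support w ->
  two_cell_support (fun b => cell_primitive xi x0 dx (w b)).
Proof.
move=> w0 k p i ik ik1; rewrite /cell_primitive -[RHS](interpolate0 i).
congr interpolate; apply/funext => r; rewrite w0// integral0//.
by rewrite cell_leftE nodeE lerD2l ler_pM2l ?lobatto_ge0.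
Qed.

Lemma cell_primitive_translation w : translation_invariant w ->
  translation_invariant (fun b => cell_primitive xi x0 dx (w b)).
Proof.
move=> wT k p i; rewrite /cell_primitive -[RHS]pull_interpolate.
congr (pull _ (interpolate _ _ _ _ _)); apply/funext => r.
by rewrite !cell_leftE !nodeE !integral_comp_affine ?lobatto_ge0// -!/(pull _ _) wT.
Qed.

(** * Factorization of the symbols *)

(** The symbol of w |-> w' from the finite element space to piecewise
    polynomials of degree < K; the derivative is taken in the reference
    coordinate and expanded in its monomials.  Only basis functions attached to
    cells 0 and -1 contribute on cell 0. *)
Definition trial_symbol (w : dof K -> piecewise R) (t : R[i]) : 'M[R[i]]_K :=
  \matrix_(m, p) (((pull 0 (w (0, p) 0))^`()`_m)%:C%C
                  + ((pull 0 (w (-1, p) 0))^`()`_m)%:C%C * t^-1).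

(** The symbol of testing a piecewise polynomial of degree < K, given by its
    monomial coefficients, against psi. *)
Definition test_symbol (psi : dof K -> piecewise R) (t : R[i]) : 'M[R[i]]_K :=
  \matrix_(s, m) ((Defs.integral 0 1 (pull 0 (psi (0, s) 0) * 'X^m))%:C%C
                  + (Defs.integral 0 1 (pull 1 (psi (0, s) 1) * 'X^m))%:C%C * t).

(** The operator is testing after differentiating, both translation invariant, and
    symbols turn composition into matrix product: the entry of the product is a
    discrete convolution over the cell i on which the two functions meet. *)
Lemma symbol_factor psi w t :
  t != 0 -> two_cell_support psi ->
  two_cell_support w -> translation_invariant w ->
  (forall b i, (size (w b i) <= K.+1)%N) ->
  symbol (fun a b => \sum_(i \in [set: int])
    Defs.integral (cell_left x0 dx i) (cell_right x0 dx i)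
      (psi a i * (w b i)^`())) t = test_symbol psi t *m trial_symbol w t.
Proof.
move=> t0 psi0 w0 wT szw; apply/matrixP => s p; rewrite !mxE.
(* Coefficients of the test map on cell i, and of the derivative on cell i of the
   trial function attached to cell k. *)
pose B i (m : 'I_K) := Defs.integral 0 1 (pull i (psi (0, s) i) * 'X^m).
pose G i k (m : 'I_K) := (pull i (w (k, p) i))^`()`_m.
(* The factor dx of the change of variables in the integral cancels the 1 / dx of
   the derivative. *)
have cellE i k : Defs.integral (cell_left x0 dx i) (cell_right x0 dx i)
      (psi (0, s) i * (w (k, p) i)^`()) = \sum_m B i m * G i k m.
  rewrite cell_leftE cell_rightE integral_comp_affine ?ler01//.
  rewrite comp_polyM -!/(pull _ _).
  set d := pull i (w (k, p) i)^`().
  have dE : (pull i (w (k, p) i))^`() = dx *: d.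
    rewrite /d /pull deriv_comp derivD derivZ derivX derivC addr0.
    by rewrite -scalerAr mulr1.
  have -> : pull i (psi (0, s) i) * d =
      \sum_(m < K) d`_m *: (pull i (psi (0, s) i) * 'X^m).
    have szd : (size d <= K)%N.
      rewrite size_comp_affine// size_deriv; have := szw (k, p) i.
      by case: (size _).
    have dK : d = \sum_(m < K) d`_m *: 'X^m.
      rewrite -(poly_def K (fun m => d`_m)); apply/polyP => m; rewrite coef_poly.
      by case: ltnP => // Km; rewrite nth_default// (leq_trans szd).
    by rewrite [in LHS]dK mulr_sumr; apply: eq_bigr => m _; rewrite scalerAr.
  rewrite integral_lincomb ?ler01// mulr_sumr; apply: eq_bigr => m _.
  by rewrite /B /G dE coefZ; ring.
have G0 i k m : i != k -> i != k + 1 -> G i k m = 0.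
  by move=> ik ik1; rewrite /G w0// /pull comp_poly0 deriv0 coef0.
have B0 i m : i != 0 -> i != 1 -> B i m = 0.
  by move=> i0 i1; rewrite /B psi0// /pull comp_poly0 mul0r integral0 ?ler01.
have GT i k m : G (i + 1) (k + 1) m = G i k m by rewrite /G wT.
have entryE k : \sum_(i \in [set: int])
    Defs.integral (cell_left x0 dx i) (cell_right x0 dx i)
      (psi (0, s) i * (w (k, p) i)^`()) =
    \sum_m (B 0 m * G 0 k m + B 1 m * G 1 k m).
  rewrite (@fsbig_int_support _ [:: 0; 1])//; last first.
    move=> i; rewrite !inE negb_or cellE => /andP[i0 i1].
    by rewrite big1// => m _; rewrite B0// mul0r.
  by rewrite !big_cons big_nil addr0 !cellE big_split.
pose c k := \sum_m (B 0 m * G 0 k m + B 1 m * G 1 k m).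
transitivity (\sum_(k \in [set: int]) (c k)%:C%C * t ^ k).
  by apply: eq_fsbigr => k _; rewrite entryE.
rewrite (@fsbig_int_support _ [:: -1; 0; 1])//; last first.
  move=> k; rewrite !inE !negb_or => /and3P[kN1 k0 k1].
  rewrite /c big1 ?mul0r// => m _.
  by rewrite !G0 ?mulr0 ?addr0//; lia.
have cN1 : c (-1) = \sum_m B 0 m * G 0 (-1) m.
  by apply: eq_bigr => m _; rewrite (@G0 1) ?mulr0 ?addr0.
have c0 : c 0 = \sum_m (B 0 m * G 0 0 m + B 1 m * G 0 (-1) m).
  by apply: eq_bigr => m _; rewrite -(GT 0 (-1)).
have c1 : c 1 = \sum_m B 1 m * G 0 0 m.
  by apply: eq_bigr => m _; rewrite (@G0 0) ?mulr0 ?add0r// -(GT 0 0).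
rewrite 3!big_cons big_nil addr0 cN1 c0 c1.
under [RHS]eq_bigr do rewrite !mxE -/(B 0 _) -/(B 1 _) -/(G 0 0 _) -/(G 0 (-1) _).
rewrite !raddf_sum !mulr_suml -!big_split /=; apply: eq_bigr => m _.
rewrite !rmorphD !rmorphM /= expr0z expr1z exprN1.
by field.
Qed.

Let phi_deriv : dof K -> piecewise R := fun b i => (phi xi x0 dx b i)^`().
Let phi_primitive : dof K -> piecewise R :=
  fun b => cell_primitive xi x0 dx (phi xi x0 dx b).

Lemma phi_deriv_support : two_cell_support phi_deriv.
Proof. by move=> k p i ik ik1; rewrite /phi_deriv phi_support// deriv0. Qed.

Lemma size_phi a i : (size (phi xi x0 dx a i) <= K.+1)%N.
Proof. exact: size_interpolate. Qed.

Lemma size_phi_deriv a i : (size (phi_deriv a i) <= K)%N.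
Proof. by rewrite size_deriv; have := size_phi a i; case: (size _). Qed.

(** Testing against phi serves both D_x and D_x I_x because the quadrature in the
    former is exact; likewise testing against phi' for D^x_x and D^x_x I_x. *)
Lemma symbols_factor t : t != 0 ->
  [/\ symbol (mat_Dl xi x0 dx) t =
        test_symbol (phi xi x0 dx) t *m trial_symbol (phi xi x0 dx) t,
      symbol (mat_DlI xi x0 dx) t =
        test_symbol (phi xi x0 dx) t *m trial_symbol phi_primitive t,
      symbol (mat_Dul xi x0 dx) t =
        test_symbol phi_deriv t *m trial_symbol (phi xi x0 dx) t
    & symbol (mat_DulI xi x0 dx) t =
        test_symbol phi_deriv t *m trial_symbol phi_primitive t].
Proof.
move=> t0.
have supp := phi_support; have dsupp := phi_deriv_support.
have psupp := cell_primitive_support supp.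
have trans := phi_translation; have ptrans := cell_primitive_translation trans.
have psz b i : (size (phi_primitive b i) <= K.+1)%N by exact: size_interpolate.
have szM (p q : {poly R}) : (size p <= K.+1)%N -> (size q <= K)%N ->
    (size (p * q)%R <= 2 * K)%N.
  by move=> szp szq; apply: (leq_trans (size_polyMleq _ _)); lia.
split.
- rewrite -symbol_factor//; last exact: size_phi.
  congr (symbol _ _); apply/funext => a; apply/funext => b; rewrite /mat_Dl.
  apply: eq_fsbigr => i _; rewrite quadrature_exact// szM ?size_phi//.
  exact: size_phi_deriv.
- by rewrite -symbol_factor.
- rewrite -symbol_factor//; last exact: size_phi.
  congr (symbol _ _); apply/funext => a; apply/funext => b; rewrite /mat_Dul.
  apply: eq_fsbigr => i _; rewrite quadrature_exact// szM//.
    exact: leqW (size_phi_deriv _ _).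
  exact: size_phi_deriv.
- by rewrite -symbol_factor.
Qed.

End Grid.

(** * Rank of the symbol and its left kernel *)

Lemma left_kernel_rows (F : fieldType) (N n : nat) (E : 'M[F]_N) :
  (\rank E + n <= N)%N ->
  exists2 L : 'M[F]_(n, N), row_free L & L *m E = 0.
Proof.
move=> rkE; have le_n : (n <= \rank (kermx E))%N.
  by rewrite mxrank_ker leq_subRL ?rank_leq_row.
exists (pid_mx n *m row_base (kermx E)).
  rewrite /row_free mxrankMfree ?row_base_free// rank_pid_mx//.
by apply/sub_kermxP/(submx_trans (submxMl _ _)); rewrite eq_row_base.
Qed.

(** The first two block columns factor through a space of dimension K^2, as T U
    below; the third one, P V, has only K^2 columns. *)
Lemma rank_supg (F : fieldType) (K : nat)
    (Bx Cx Gx Hx By Cy Gy Hy : 'M[F]_K)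
    (Dx DxI Dxx DxxI Dy DyI Dyy DyyI : 'M[F]_K)
    (a : F) (E13 E23 E33 : 'M[F]_(K * K)) :
  [/\ Dx = Bx *m Gx, DxI = Bx *m Hx, Dxx = Cx *m Gx & DxxI = Cx *m Hx] ->
  [/\ Dy = By *m Gy, DyI = By *m Hy, Dyy = Cy *m Gy & DyyI = Cy *m Hy] ->
  (\rank (block3_mx
      (a *: (Dxx *t DyI)) (a *: (DxxI *t Dy)) E13
      (a *: (Dx *t DyyI)) (a *: (DxI *t Dyy)) E23
      (Dx *t DyI)         (DxI *t Dy)         E33) <= K * K + K * K)%N.
Proof.
move=> [-> -> -> ->] [-> -> -> ->].
set E := block3_mx _ _ _ _ _ _ _ _ _.
pose T := col_mx (a *: (Cx *t By)) (col_mx (a *: (Bx *t Cy)) (Bx *t By)).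
pose U := row_mx (Gx *t Hy) (row_mx (Hx *t Gy) (0 : 'M[F]_(K * K))).
pose P := col_mx E13 (col_mx E23 E33).
pose V := row_mx (0 : 'M[F]_(K * K))
            (row_mx (0 : 'M[F]_(K * K)) (1%:M : 'M[F]_(K * K))).
have -> : E = T *m U + P *m V.
  rewrite /T /U /P /V !mul_col_row !mul_mx_row !mul_col_mx !mulmx0 !mulmx1.
  rewrite !col_mx0 -!scalemxAl !tensmx_mul /E /block3_mx.
  by rewrite !(add_block_mx, add_row_mx, addr0, add0r).
apply: leq_trans (mxrank_add _ _) _; apply: leq_add.
  exact: leq_trans (mxrankM_maxl _ _) (rank_leq_col _).
exact: leq_trans (mxrankM_maxl _ _) (rank_leq_col _).
Qed.

(** * Conserved quantities *)

Lemma derive0_cst_itv (R : realType) (J : interval R) (f : R -> R) :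
  {within [set` J], continuous f} ->
  (forall t, [set` J]° t -> is_derive t 1 f 0) ->
  {in J &, forall s t, f s = f t}.
Proof.
move=> cf df.
suff H s t : s \in J -> t \in J -> s < t -> f s = f t.
  move=> s t sJ tJ; case: (ltgtP s t) => [st|ts|->//]; first exact: H.
  by rewrite (H t s).
move=> sJ tJ st.
have sub : `[s, t] `<=` [set` J].
  by move=> x /=; rewrite in_itv/=; exact: interval_is_interval.
have df' x : x \in `]s, t[ -> is_derive x 1 f 0.
  move=> xst; apply: df; rewrite /interior.
  apply: filterS (near_in_itvoo xst) => y yst; apply: sub.
  exact: subset_itv_oo_cc.
have [c _] := MVT_segment (ltW st) df' (continuous_subspaceW sub cf).
by rewrite mul0r => /eqP; rewrite subr_eq0 => /eqP.
Qed.

(** Solutions are differentiated through real and imaginary parts, so constancy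
    is first obtained for real combinations of these parts. *)
Lemma real_combination_cst (R : realType) (n : nat) (A E : 'M[R[i]]_n)
    (J : interval R) (q : R -> 'cV[R[i]]_n) (a b : 'I_n -> R) :
  is_solution A E J q ->
  (forall (t : R) (dq : 'cV[R[i]]_n), A *m dq + E *m q t = 0 ->
    \sum_(j < n) (a j * complex.Re (dq j 0) + b j * complex.Im (dq j 0)) = 0) ->
  {in J &, forall s t,
    \sum_(j < n) (a j * complex.Re (q s j 0) + b j * complex.Im (q s j 0)) =
    \sum_(j < n) (a j * complex.Re (q t j 0) + b j * complex.Im (q t j 0))}.
Proof.
move=> [cq dq] ab0.
pose h j : R -> R :=
  a j *: (fun t => complex.Re (q t j 0)) + b j *: (fun t => complex.Im (q t j 0)).
have sumE t : \sum_(j < n) (a j * complex.Re (q t j 0) + b j * complex.Im (q t j 0))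
   = (\sum_(j < n) h j) t by rewrite fct_sumE.
move=> s t sJ tJ; rewrite !sumE; apply: derive0_cst_itv sJ tJ.
- elim/big_ind : _ => [|f g cf cg|j _].
  + by move=> x; apply: cvg_cst.
  + exact: within_continuousD.
  + by have [cr ci] := cq j; apply: within_continuousD => x; apply: cvgZr;
     [exact: cr | exact: ci].
- move=> u /dq[dqu der eqn]; rewrite -(ab0 u dqu eqn).
  have dh j : is_derive u 1 (h j)
      (a j * complex.Re (dqu j 0) + b j * complex.Im (dqu j 0)).
    have [dr di] := der j.
    exact: is_deriveD (is_deriveZ (a j) dr) (is_deriveZ (b j) di).
  elim/big_ind2 : _ => [|f df g dg fE gE|j _]; last exact: dh.
    exact: is_derive_cst.
  exact: is_deriveD.
Qed.

Lemma left_kernel_conserved (R : realType) (n : nat) (A E : 'M[R[i]]_n) (l : 'rV[R[i]]_n)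
    (J : interval R) (q : R -> 'cV[R[i]]_n) :
  l *m E = 0 -> is_solution A E J q ->
  {in J &, forall s t, l *m A *m q s = l *m A *m q t}.
Proof.
move=> lE sol s t sJ tJ; set c := l *m A.
have ReE (v : 'cV[R[i]]_n) : complex.Re ((c *m v) 0 0) =
    \sum_(j < n) (complex.Re (c 0 j) * complex.Re (v j 0)
                  + - complex.Im (c 0 j) * complex.Im (v j 0)).
  rewrite mxE raddf_sum; apply: eq_bigr => j _.
  by case: (c 0 j) (v j 0) => [x y] [z w] /=; rewrite mulNr.
have ImE (v : 'cV[R[i]]_n) : complex.Im ((c *m v) 0 0) =
    \sum_(j < n) (complex.Im (c 0 j) * complex.Re (v j 0)
                  + complex.Re (c 0 j) * complex.Im (v j 0)).
  rewrite mxE raddf_sum; apply: eq_bigr => j _.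
  by case: (c 0 j) (v j 0) => [x y] [z w] /=; rewrite addrC.
have cdq (u : R) (dq : 'cV[R[i]]_n) : A *m dq + E *m q u = 0 -> c *m dq = 0.
  move=> /(congr1 (mulmx l)); rewrite mulmx0 mulmxDr mulmxA => <-.
  by rewrite mulmxA lE mul0mx addr0.
apply/matrixP => i j; rewrite !ord1; apply/eqP; rewrite eq_complex.
rewrite !ReE !ImE; apply/andP; split; apply/eqP.
- apply: (real_combination_cst sol _ sJ tJ) => u dq /cdq eqn.
  by rewrite -ReE eqn mxE.
- apply: (real_combination_cst sol _ sJ tJ) => u dq /cdq eqn.
  by rewrite -ImE eqn mxE.
Qed.

Unset Implicit Arguments.

Theorem proposition5p4 (R : realType) (K : nat) (hK : (1 <= K)%N)
    (xi : 'I_K.+1 -> R) (hxi : gauss_lobatto xi)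
    (x0 y0 dx dy : R) (hdx : 0 < dx) (hdy : 0 < dy) (alpha : R)
    (tx ty : R[i]) (htx : `|tx| = 1) (hty : `|ty| = 1) :
  exists ell : 'I_(K ^ 2) -> 'cV[R[i]]_(K * K + (K * K + K * K)),
    [/\ row_free (\matrix_(m < K ^ 2) (ell m)^T),
        forall m : 'I_(K ^ 2),
          (ell m)^T *m Ehat xi x0 y0 dx dy alpha tx ty = 0
      & forall (J : interval R)
          (q : R -> 'cV[R[i]]_(K * K + (K * K + K * K))),
          is_solution (Ahat xi x0 y0 dx dy alpha tx ty)
                      (Ehat xi x0 y0 dx dy alpha tx ty) J q ->
          forall (m : 'I_(K ^ 2)) (s t : R), s \in J -> t \in J ->
            (ell m)^T *m Ahat xi x0 y0 dx dy alpha tx ty *m q s =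
            (ell m)^T *m Ahat xi x0 y0 dx dy alpha tx ty *m q t].
Proof.
have [tx0 ty0] : tx != 0 /\ ty != 0.
  by rewrite -(normr_eq0 tx) -(normr_eq0 ty) htx hty oner_eq0.
have rkE : (\rank (Ehat xi x0 y0 dx dy alpha tx ty) <= K * K + K * K)%N.
  exact: rank_supg (symbols_factor x0 hK hxi hdx tx0)
                   (symbols_factor y0 hK hxi hdy ty0).
have room r : (r <= K * K + K * K -> r + K ^ 2 <= K * K + (K * K + K * K))%N.
  by rewrite -mulnn addnA leq_add2r.
have [L freeL LE] := left_kernel_rows (room _ rkE).
exists (fun m => (row m L)^T).
have rowE m : (row m L)^T^T *m Ehat xi x0 y0 dx dy alpha tx ty = 0.
  by rewrite trmxK -row_mul LE row0.
split=> [|//|J q sol m s t sJ tJ].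
- suff -> : \matrix_(m < K ^ 2) (row m L)^T^T = L by [].
  by apply/row_matrixP => m; rewrite rowK trmxK.
- exact: left_kernel_conserved (rowE m) sol _ _ sJ tJ.
Qed.
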